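(* For any nonzero scalars $k_0,k_1,k_2,k_3\in\mathbb{F}$ there exists an $\mathfrak{H}_q$-module $M(k_0,k_1,k_2,k_3)$ satisfying the following conditions: (i) There exists an $\mathbb{F}$-basis $\{m_i\}_{i=0}^\infty$ for $M(k_0,k_1,k_2,k_3)$ such that - $t_0m_i=k_0^{-1}q^{-i}(1-q^i)(1-k_0^2q^i)m_{i-1}+(k_0+k_0^{-1}-k_0^{-1}q^{-i})m_i$ for $i=2,4,\ldots$; $t_0m_i=k_0^{-1}q^{-i-1}(m_i-m_{i+1})$ for $i=1,3,\ldots$; $t_0m_0=k_0m_0$; - $t_1m_i=-k_1(1-q^i)(1-k_0^2q^i)m_{i-1}+k_1m_i+k_1^{-1}m_{i+1}$ for $i=2,4,\ldots$; $t_1m_i=k_1^{-1}m_i$ for $i=1,3,\ldots$; $t_1m_0=k_1m_0+k_1^{-1}m_1$; - $t_2m_i=k_0^{-1}k_1^{-1}k_3^{-1}q^{-i-1}(m_i-m_{i+1})$ for $i=0,2,\ldots$; $t_2m_i=\frac{(k_0k_1k_3q^i-k_2)(k_0k_1k_3q^i-k_2^{-1})}{k_0k_1k_3q^i}m_{i-1}+(k_2+k_2^{-1}-k_0^{-1}k_1^{-1}k_3^{-1}q^{-i})m_i$ for $i=1,3,\ldots$; - $t_3m_i=k_3m_i$ for $i=0,2,\ldots$; $t_3m_i=-k_3^{-1}(k_0k_1k_3q^i-k_2)(k_0k_1k_3q^i-k_2^{-1})m_{i-1}+k_3^{-1}m_i+k_3m_{i+1}$ for $i=1,3,\ldots$.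 (ii) The elements $c_0,c_1,c_2,c_3$ act on $M(k_0,k_1,k_2,k_3)$ as scalar multiplication by $k_0+k_0^{-1}$, $k_1+k_1^{-1}$, $k_2+k_2^{-1}$, $k_3+k_3^{-1}$ respectively.
   Context: $\mathbb{F}$ is a field and $q\in\mathbb{F}$ is nonzero. The universal DAHA $\mathfrak{H}_q$ of type $(C_1^\vee,C_1)$ is the unital associative $\mathbb{F}$-algebra with generators $t_0^{\pm1},t_1^{\pm1},t_2^{\pm1},t_3^{\pm1}$ and relations: $t_it_i^{-1}=t_i^{-1}t_i=1$ for all $i$; $t_i+t_i^{-1}$ is central for all $i$; $t_0t_1t_2t_3=q^{-1}$. Put $c_i=t_i+t_i^{-1}$ for $i=0,1,2,3$. *)

(* Defs.v *)
From HB Require Import structures.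
From mathcomp Require Import all_boot all_algebra.
From mathcomp Require Import finmap boolp.
From mathcomp.multinomials Require Import monalg.

Set Implicit Arguments.
Unset Strict Implicit.
Unset Printing Implicit Defensive.

Import GRing.Theory.
Local Open Scope ring_scope.
Local Open Scope quotient_scope.

(* The free unital associative F-algebra on eight letters, as the monoid      *)
(* algebra of the free monoid: the letter (i, false) stands for t_i and       *)
(* (i, true) for t_i^-1.                                                      *)
Notation free_alg F := {malg F[{fmonom ('I_4 * bool)%type}]}.

Section UniversalDAHA.
Context {F : fieldType}.
Variable q : F.

Definition letter (i : 'I_4) (b : bool) : free_alg F := << fmu (i, b) >>.

Inductive relator : free_alg F -> Prop :=
| RelV i : relator (letter i false * letter i true - 1)
| RelVl i : relator (letter i true * letter i false - 1)
| RelC i x :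
    relator ((letter i false + letter i true) * x
             - x * (letter i false + letter i true))
| RelQ :
    relator (letter 0 false * letter 1 false * letter 2 false * letter 3 false
             - q^-1 *: 1).

(* The two-sided ideal generated by the relators.                             *)
Inductive relator_ideal : free_alg F -> Prop :=
| RelIn x of relator x : relator_ideal x
| Rel0 : relator_ideal 0
| RelD x y of relator_ideal x & relator_ideal y : relator_ideal (x + y)
| RelMl a x of relator_ideal x : relator_ideal (a * x)
| RelMr x a of relator_ideal x : relator_ideal (x * a).

Definition in_ideal : {pred free_alg F} := fun x => `[< relator_ideal x >].

Lemma in_idealP x : reflect (relator_ideal x) (x \in in_ideal).
Proof. exact: asboolP. Qed.

Lemma in_ideal_zmod_closed : zmod_closed in_ideal.
Proof.
split=> [|x y /in_idealP Ix /in_idealP Iy]; apply/in_idealP; first exact: Rel0.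
by apply: RelD Ix _; rewrite -mulN1r; apply: RelMl.
Qed.

HB.instance Definition _ :=
  GRing.isZmodClosed.Build (free_alg F) in_ideal in_ideal_zmod_closed.

Definition udaha : Type := Quotient.quot in_ideal.

HB.instance Definition _ := GRing.Zmodule.copy udaha (Quotient.quot in_ideal).

Definition udaha_pi (x : free_alg F) : udaha := \pi_udaha x.

Lemma udaha_piP x y : udaha_pi x = udaha_pi y <-> relator_ideal (x - y).
Proof.
split=> [/eqP|/in_idealP]; last by rewrite Quotient.idealrBE => /eqP.
by rewrite -Quotient.idealrBE => /in_idealP.
Qed.

Lemma udaha_piK x : udaha_pi (repr x) = x.
Proof. exact: reprK. Qed.

Lemma udaha_pi_surj (P : udaha -> Prop) :
  (forall x, P (udaha_pi x)) -> forall x, P x.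
Proof. by move=> Ppi x; rewrite -[x]udaha_piK. Qed.

Lemma udaha_piD x y : udaha_pi (x + y) = udaha_pi x + udaha_pi y.
Proof. exact: Quotient.pi_add. Qed.

Definition umul : udaha -> udaha -> udaha := lift_op2 udaha *%R.
Definition uone : udaha := lift_cst udaha 1.
Definition uscale (a : F) : udaha -> udaha := lift_op1 udaha ( *:%R a).

Lemma udaha_pi1 : udaha_pi 1 = uone.
Proof. by rewrite /uone; unlock. Qed.

Lemma udaha_piM x y : udaha_pi (x * y) = umul (udaha_pi x) (udaha_pi y).
Proof.
rewrite /umul; unlock; apply/udaha_piP; set x' := repr _; set y' := repr _.
have Ix : relator_ideal (x - x') by apply/udaha_piP; rewrite udaha_piK.
have Iy : relator_ideal (y - y') by apply/udaha_piP; rewrite udaha_piK.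
have -> : x * y - x' * y' = (x - x') * y + x' * (y - y').
  by rewrite mulrBl mulrBr addrA subrK.
by apply: RelD; [apply: RelMr|apply: RelMl].
Qed.

Lemma udaha_piZ a x : udaha_pi (a *: x) = uscale a (udaha_pi x).
Proof.
rewrite /uscale; unlock; apply/udaha_piP; rewrite -scalerBr -mul_malgC; apply: RelMl.
by apply/udaha_piP; rewrite udaha_piK.
Qed.

Lemma umulA : associative umul.
Proof.
elim/udaha_pi_surj=> x; elim/udaha_pi_surj=> y; elim/udaha_pi_surj=> z.
by rewrite -!udaha_piM mulrA.
Qed.

Lemma umul1r : left_id uone umul.
Proof. by elim/udaha_pi_surj=> x; rewrite -udaha_pi1 -!udaha_piM mul1r. Qed.

Lemma umulr1 : right_id uone umul.
Proof. by elim/udaha_pi_surj=> x; rewrite -udaha_pi1 -!udaha_piM mulr1. Qed.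

Lemma umulDl : left_distributive umul +%R.
Proof.
elim/udaha_pi_surj=> x; elim/udaha_pi_surj=> y; elim/udaha_pi_surj=> z.
by rewrite -!(udaha_piM, udaha_piD) mulrDl.
Qed.

Lemma umulDr : right_distributive umul +%R.
Proof.
elim/udaha_pi_surj=> x; elim/udaha_pi_surj=> y; elim/udaha_pi_surj=> z.
by rewrite -!(udaha_piM, udaha_piD) mulrDr.
Qed.

(* Not declared as an algType F, which would require 1 != 0: this fails when  *)
(* q = 0, and is a theorem otherwise.                                         *)
HB.instance Definition _ :=
  GRing.Zmodule_isPzRing.Build udaha umulA umul1r umulr1 umulDl umulDr.

Lemma udaha_pi_mul x y : udaha_pi (x * y) = udaha_pi x * udaha_pi y.
Proof. exact: udaha_piM. Qed.

Lemma udaha_pi_one : udaha_pi 1 = 1.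
Proof. exact: udaha_pi1. Qed.

Lemma uscaleA a b x : uscale a (uscale b x) = uscale (a * b) x.
Proof.
by elim/udaha_pi_surj: x => x; rewrite -!udaha_piZ scalerA.
Qed.

Lemma uscale1r : left_id 1 uscale.
Proof. by elim/udaha_pi_surj=> x; rewrite -!udaha_piZ scale1r. Qed.

Lemma uscaleDr : right_distributive uscale +%R.
Proof.
move=> a; elim/udaha_pi_surj=> x; elim/udaha_pi_surj=> y.
by rewrite -!(udaha_piZ, udaha_piD) scalerDr.
Qed.

Lemma uscaleDl x : {morph uscale^~ x : a b / a + b}.
Proof.
by elim/udaha_pi_surj: x => x a b; rewrite -!(udaha_piZ, udaha_piD) scalerDl.
Qed.

HB.instance Definition _ :=
  GRing.Zmodule_isLmodule.Build F udaha uscaleA uscale1r uscaleDr uscaleDl.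

Lemma uscaleAl (a : F) (x y : udaha) : a *: (x * y) = a *: x * y.
Proof.
elim/udaha_pi_surj: x => x; elim/udaha_pi_surj: y => y.
by rewrite /GRing.scale /GRing.mul/= -!(udaha_piM, udaha_piZ) scalerAl.
Qed.

Lemma free_scalerAr (a : F) (x y : free_alg F) : a *: (x * y) = x * (a *: y).
Proof.
apply/malgP => k; rewrite mcoeffZ (mcoeffMlw _ (fsubset_refl _) (msuppZ_le _ _)).
rewrite mcoeffMl mulr_sumr; apply: eq_bigr => i _.
rewrite mulr_sumr; apply: eq_bigr => j _.
by rewrite mcoeffZ mulrnAr mulrCA.
Qed.

Lemma uscaleAr (a : F) (x y : udaha) : a *: (x * y) = x * (a *: y).
Proof.
elim/udaha_pi_surj: x => x; elim/udaha_pi_surj: y => y.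
rewrite /GRing.scale /GRing.mul/= -!(udaha_piM, udaha_piZ).
by rewrite free_scalerAr.
Qed.

Definition udaha_C (a : F) : udaha := a *: (1 : udaha).

Lemma udaha_C_pi a : udaha_C a = udaha_pi (a *: 1).
Proof. by rewrite udaha_piZ udaha_pi1. Qed.

Definition daha_t (i : 'I_4) : udaha := udaha_pi (letter i false).
Definition daha_tV (i : 'I_4) : udaha := udaha_pi (letter i true).
Definition daha_c (i : 'I_4) : udaha := daha_t i + daha_tV i.

Lemma udaha_rel x y : relator (x - y) -> udaha_pi x = udaha_pi y.
Proof. by move=> r; apply/udaha_piP/RelIn. Qed.

Lemma daha_tK i : daha_t i * daha_tV i = 1.
Proof. by rewrite -udaha_pi_one -udaha_pi_mul; apply: udaha_rel; apply: RelV. Qed.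

Lemma daha_tVK i : daha_tV i * daha_t i = 1.
Proof. by rewrite -udaha_pi_one -udaha_pi_mul; apply: udaha_rel; apply: RelVl. Qed.

Lemma daha_c_central i x : daha_c i * x = x * daha_c i.
Proof.
elim/udaha_pi_surj: x => x; rewrite /daha_c -udaha_piD -!udaha_pi_mul.
by apply: udaha_rel; apply: RelC.
Qed.

Lemma daha_t_prod : daha_t 0 * daha_t 1 * daha_t 2 * daha_t 3 = udaha_C q^-1.
Proof.
by rewrite udaha_C_pi -!udaha_pi_mul; apply: udaha_rel; apply: RelQ.
Qed.

End UniversalDAHA.

(* The F-vector space structure underlying an H_q-module, by restriction of   *)
(* scalars along F -> H_q.                                                    *)
Definition fscale (F : fieldType) (q : F) (M : lmodType (udaha q))
  (a : F) (v : M) : M := udaha_C q a *: v.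

Notation "a *:F v" := (fscale a v)
  (at level 40, left associativity, format "a  *:F  v") : ring_scope.

Definition fbasis (F : fieldType) (q : F) (M : lmodType (udaha q))
    (m : nat -> M) : Prop :=
  (forall (n : nat) (a : nat -> F),
      \sum_(i < n) a i *:F m i = 0 -> forall i, (i < n)%N -> a i = 0)
  /\ (forall v : M, exists (n : nat) (a : nat -> F),
        v = \sum_(i < n) a i *:F m i).

(* Main.v *)
Require Import Defs.
From HB Require Import structures.
From mathcomp Require Import all_boot all_algebra.
From mathcomp Require Import finmap ring.
From mathcomp.multinomials Require Import monalg.

Set Implicit Arguments.
Unset Strict Implicit.
Unset Printing Implicit Defensive.

Import GRing.Theory.
Local Open Scope ring_scope.

(** The module is the space of polynomials {poly F}, whose monomials 'X^n are
    the basis vectors m_n; each t_i acts by the linear extension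
    (monomial_ext) of the prescribed images of the monomials.

    Since c_i is to act as the scalar k_i + k_i^-1, the inverse of the
    operator T_i of t_i can only be (k_i + k_i^-1) - T_i.  With this choice
    T_i + T_i^-1 is a scalar, hence central, and inverting T_i amounts to the
    quadratic relation T_i^2 = (k_i + k_i^-1) T_i - 1.  So four operators
    define a module as soon as they satisfy these four quadratic relations
    and T_0 T_1 T_2 T_3 = q^-1; this is udaha_module_of_operators, obtained by
    letting the free algebra act by words and checking that the ideal of the
    relators acts by zero.

    The quadratic relations hold for two different reasons.  T_0 is a direct
    sum of the scalar k_0 on m_0 and of 2 x 2 blocks on the spans of m_{n-1}
    and m_n, n even, of trace k_0 + k_0^-1 and determinant 1, so that
    Cayley-Hamilton applies; T_2 is a direct sum of such blocks, now for n odd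
    and with k_2 in place of k_0.  T_1 acts on the span of the m_n, n odd, as
    k_1^-1, and T_1 - k_1 maps the other basis vectors into that span, hence
    (T_1 - k_1^-1) (T_1 - k_1) = 0; T_3 is similar, with the parities
    exchanged.  The product relation is a computation: for n even, T_2 T_3 m_n
    is a multiple of m_n - m_{n+1}, from which T_1 cancels m_{n+1}, leaving a
    combination of m_{n-1} and m_n that T_0 maps to a multiple of m_n; for n
    odd, all terms are expanded.  In the coefficients of each monomial, all
    these relations are identities between rational functions of q, the k_i
    and q^n. *)

(** * Modules over the free algebra *)

Section FreeAlgebraAction.
Context (F : fieldType) (I : choiceType) (V : lmodType F).
Context (L : I -> {linear V -> V}).
Local Notation A := {malg F[{fmonom I}]}.

Definition word_act (w : {fmonom I}) (v : V) : V :=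
  foldr (fun i u => L i u) v (w : seq I).

Lemma word_act_is_linear w : linear (word_act w).
Proof.
move=> a u v; rewrite /word_act.
by elim: (w : seq I) => //= i s ->; rewrite linearP.
Qed.

HB.instance Definition _ w :=
  GRing.isLinear.Build F V V _ (word_act w) (word_act_is_linear w).

Lemma word_act1 v : word_act (@mone _) v = v.
Proof. by rewrite /word_act fm1. Qed.

Lemma word_actU i v : word_act (fmu i) v = L i v.
Proof. by rewrite /word_act fmU. Qed.

Lemma word_actM w1 w2 v :
  word_act (mmul w1 w2) v = word_act w1 (word_act w2 v).
Proof. by rewrite /word_act fmM foldr_cat. Qed.

Definition free_act (g : A) (v : V) : V :=
  \sum_(w <- msupp g) g@_w *: word_act w v.

Lemma free_actEw (d : {fset {fmonom I}}) g v :
  (msupp g `<=` d)%fset ->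
  free_act g v = \sum_(w <- d) g@_w *: word_act w v.
Proof.
move=> le; rewrite /free_act; apply: big_fset_incl => // w _ /mcoeff_outdom ->.
by rewrite scale0r.
Qed.

Lemma free_actDl v : {morph free_act^~ v : g h / g + h}.
Proof.
move=> g h.
pose d := (msupp g `|` msupp h)%fset.
rewrite !(@free_actEw d) ?msuppD_le ?fsubsetUl ?fsubsetUr //.
by rewrite -big_split; apply: eq_bigr => w _; rewrite mcoeffD scalerDl.
Qed.

Lemma free_act0l v : free_act 0 v = 0.
Proof. by rewrite /free_act msupp0 big_nil. Qed.

Lemma free_act_sum (J : Type) (r : seq J) (G : J -> A) v :
  free_act (\sum_(j <- r) G j) v = \sum_(j <- r) free_act (G j) v.
Proof. exact: (big_morph _ (free_actDl v) (free_act0l v)). Qed.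

Lemma free_actBl g h v : free_act (g - h) v = free_act g v - free_act h v.
Proof. by apply/eqP; rewrite eq_sym subr_eq -free_actDl subrK. Qed.

Lemma free_actU a w v : free_act << a *g w >> v = a *: word_act w v.
Proof. by rewrite (free_actEw _ msuppU_le) big_seq_fset1 mcoeffUU. Qed.

Lemma free_act_is_linear g : linear (free_act g).
Proof.
move=> a u v; rewrite /free_act scaler_sumr -big_split /=.
apply: eq_bigr => w _; rewrite linearP scalerDr !scalerA.
by rewrite [a * _]mulrC.
Qed.

HB.instance Definition _ g :=
  GRing.isLinear.Build F V V _ (free_act g) (free_act_is_linear g).

Lemma free_actM g h v : free_act (g * h) v = free_act g (free_act h v).
Proof.
rewrite malgME free_act_sum [RHS]/free_act; apply: eq_bigr => w1 _.
rewrite free_act_sum [free_act h v]/free_act linear_sum scaler_sumr.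
apply: eq_bigr => w2 _.
by rewrite free_actU linearZ scalerA word_actM.
Qed.

Lemma free_act1 v : free_act 1 v = v.
Proof. by rewrite free_actU word_act1 scale1r. Qed.

Lemma free_actZl a g v : free_act (a *: g) v = a *: free_act g v.
Proof. by rewrite -mul_malgC free_actM free_actU word_act1. Qed.

End FreeAlgebraAction.

(** * Modules on which the c_i are scalars *)

Section LiftToDAHA.
Context (F : fieldType) (q : F) (V : lmodType F).
Context (S : 'I_4 -> {linear V -> V}) (c : 'I_4 -> F).
Context (S_quadratic : forall i v, S i (S i v) = c i *: S i v - v).
Context (S_product : forall v, S 0 (S 1 (S 2 (S 3 v))) = q^-1 *: v).

(** By the quadratic relation, c i - S i is the inverse of S i. *)
Definition letter_act (x : 'I_4 * bool) (v : V) : V :=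
  if x.2 then c x.1 *: v - S x.1 v else S x.1 v.

Lemma letter_act_is_linear x : linear (letter_act x).
Proof.
case: x => i [] a u v; rewrite /letter_act /= linearP //.
by rewrite !scalerDr scalerN !scalerA [c i * a]mulrC opprD addrACA.
Qed.

HB.instance Definition _ x :=
  GRing.isLinear.Build F V V _ (letter_act x) (letter_act_is_linear x).

Local Notation act := (free_act letter_act).

Lemma act_t i v : act (letter i false) v = S i v.
Proof. by rewrite free_actU scale1r word_actU. Qed.

Lemma act_tV i v : act (letter i true) v = c i *: v - S i v.
Proof. by rewrite free_actU scale1r word_actU. Qed.

Lemma act_relator x v : relator q x -> act x v = 0.
Proof.
case=> [i|i|i y|]; rewrite free_actBl !(free_actM, free_actDl).
- rewrite free_act1 act_tV act_t linearB linearZ /= S_quadratic.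
  by rewrite subKr subrr.
- by rewrite free_act1 act_t act_tV S_quadratic subKr subrr.
- by rewrite !(act_t, act_tV) ![S i _ + _]addrC !subrK linearZ subrr.
- by rewrite !act_t S_product free_actZl free_act1 subrr.
Qed.

(** The elements acting by zero form a two-sided ideal, so the relators
    suffice. *)
Lemma act_relator_ideal x v : relator_ideal q x -> act x v = 0.
Proof.
move=> Ix.
elim: Ix v => {x} [x rx v|v|x y _ IHx _ IHy v|a x _ IHx v|x a _ IHx v].
- exact: act_relator.
- exact: free_act0l.
- by rewrite free_actDl IHx IHy addr0.
- by rewrite free_actM IHx linear0.
- by rewrite free_actM IHx.
Qed.

(** The representative repr x is arbitrary: udaha_act_pi shows that the action
    does not depend on it. *)
Definition udaha_act (x : udaha q) (v : V) : V := act (repr x) v.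

Lemma udaha_act_pi x v : udaha_act (udaha_pi q x) v = act x v.
Proof.
apply/eqP; rewrite -subr_eq0 -free_actBl; apply/eqP/act_relator_ideal.
by apply/udaha_piP; rewrite udaha_piK.
Qed.

Lemma udaha_actA x y v : udaha_act x (udaha_act y v) = udaha_act (x * y) v.
Proof.
by rewrite -[x]udaha_piK -[y]udaha_piK -udaha_pi_mul !udaha_act_pi free_actM.
Qed.

Lemma udaha_act1 : left_id 1 udaha_act.
Proof. by move=> v; rewrite -udaha_pi_one udaha_act_pi free_act1. Qed.

Lemma udaha_actDr : right_distributive udaha_act +%R.
Proof. by move=> x u v; rewrite /udaha_act linearD. Qed.

Lemma udaha_actDl v : {morph udaha_act^~ v : x y / x + y}.
Proof.
move=> x y.
by rewrite -[x]udaha_piK -[y]udaha_piK -udaha_piD !udaha_act_pi free_actDl.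
Qed.

(** The carrier of M is V itself and phi is the identity.  It appears
    in the statement because V and M are modules over different rings; the
    second clause identifies the scalars of V with those that M inherits from
    the map F -> udaha q. *)
Lemma udaha_module_of_operators :
  exists (M : lmodType (udaha q)) (phi : {additive V -> M}),
    [/\ bijective phi,
        forall a v, phi (a *: v) = a *:F phi v,
        forall i v, daha_t q i *: phi v = phi (S i v)
      & forall i (w : M), daha_c q i *: w = c i *:F w].
Proof.
(* Only the additive group of V is kept before adding the new scalars. *)
pose W : zmodType := V.
pose mix := GRing.Zmodule_isLmodule.Build (udaha q) W
  udaha_actA udaha_act1 udaha_actDr udaha_actDl.
pose M : lmodType (udaha q) := HB.pack (GRing.Zmodule.sort W) mix.
exists M, (idfun : {additive W -> W}); split=> //=.
- by exists id.
- move=> a v; rewrite /fscale udaha_C_pi.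
  by rewrite [RHS]udaha_act_pi free_actZl free_act1.
- by move=> i v; rewrite [LHS]udaha_act_pi act_t.
- move=> i w; rewrite /fscale /daha_c -udaha_piD udaha_C_pi.
  rewrite [LHS]udaha_act_pi [RHS]udaha_act_pi free_actDl free_actZl free_act1.
  by rewrite act_t act_tV addrC subrK.
Qed.

End LiftToDAHA.

(** * Linear maps given by their values on monomials *)

Section MonomialExtension.
Context (F : fieldType).

Definition monomial_ext (V : lmodType F) (f : nat -> V) (p : {poly F}) : V :=
  \sum_(i < size p) p`_i *: f i.

Context (V : lmodType F).
Implicit Types (f : nat -> V) (p : {poly F}).

(** A bound common to several polynomials makes additivity a termwise
    statement. *)
Lemma monomial_extEw f n p :
  (size p <= n)%N -> monomial_ext f p = \sum_(i < n) p`_i *: f i.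
Proof.
move=> le; rewrite /monomial_ext (big_ord_widen n (fun i => p`_i *: f i) le).
rewrite [RHS](bigID (fun i : 'I_n => (i < size p)%N)) /=.
rewrite [X in _ = _ + X]big1 ?addr0 // => i; rewrite -leqNgt.
by move=> /(nth_default 0) ->; rewrite scale0r.
Qed.

Lemma monomial_ext_is_linear f : linear (monomial_ext f).
Proof.
move=> a p r; pose n := maxn (size p) (size r).
rewrite !(@monomial_extEw f n) ?leq_maxl ?leq_maxr //; last first.
  apply: leq_trans (size_polyD _ _) _.
  by rewrite geq_max leq_maxr andbT (leq_trans (size_scale_leq _ _)) ?leq_maxl.
rewrite scaler_sumr -big_split; apply: eq_bigr => i _ /=.
by rewrite coefD coefZ scalerDl scalerA.
Qed.

HB.instance Definition _ f :=
  GRing.isLinear.Build F {poly F} V _ (monomial_ext f)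
    (monomial_ext_is_linear f).

Lemma monomial_extXn f n : monomial_ext f 'X^n = f n.
Proof.
rewrite (@monomial_extEw _ n.+1) ?size_polyXn // big_ord_recr /= coefXn eqxx.
rewrite scale1r big1 ?add0r // => i _.
by rewrite coefXn ltn_eqF ?scale0r.
Qed.

Lemma eq_linear_monomial (g h : {linear {poly F} -> V}) :
  (forall n, g 'X^n = h 'X^n) -> g =1 h.
Proof.
move=> gh p; rewrite -[p]coefK poly_def !linear_sum.
by apply: eq_bigr => i _; rewrite !linearZ gh.
Qed.

End MonomialExtension.

(** * The four operators on polynomials *)

Section Operators.
Context (F : fieldType) (q k0 k1 k2 k3 : F).
Context (hq : q != 0) (hk0 : k0 != 0) (hk1 : k1 != 0) (hk2 : k2 != 0)
  (hk3 : k3 != 0).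

(** In t0_image and t1_image the factor 1 - q ^+ n vanishes at n = 0, so that
    the meaningless term 'X^(0.-1) disappears and the formula for even n also
    covers m_0. *)
Definition t0_image (n : nat) : {poly F} :=
  if odd n then (k0^-1 * q ^- n.+1) *: ('X^n - 'X^(n.+1))
  else (k0^-1 * q ^- n * (1 - q ^+ n) * (1 - k0 ^+ 2 * q ^+ n)) *: 'X^(n.-1)
       + (k0 + k0^-1 - k0^-1 * q ^- n) *: 'X^n.

Definition t1_image (n : nat) : {poly F} :=
  if odd n then k1^-1 *: 'X^n
  else (- k1 * (1 - q ^+ n) * (1 - k0 ^+ 2 * q ^+ n)) *: 'X^(n.-1)
       + k1 *: 'X^n + k1^-1 *: 'X^(n.+1).

Definition t2_image (n : nat) : {poly F} :=
  if odd n then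
    ((k0 * k1 * k3 * q ^+ n - k2) * (k0 * k1 * k3 * q ^+ n - k2^-1)
       / (k0 * k1 * k3 * q ^+ n)) *: 'X^(n.-1)
    + (k2 + k2^-1 - k0^-1 * k1^-1 * k3^-1 * q ^- n) *: 'X^n
  else (k0^-1 * k1^-1 * k3^-1 * q ^- n.+1) *: ('X^n - 'X^(n.+1)).

Definition t3_image (n : nat) : {poly F} :=
  if odd n then
    (- k3^-1 * (k0 * k1 * k3 * q ^+ n - k2)
       * (k0 * k1 * k3 * q ^+ n - k2^-1)) *: 'X^(n.-1)
    + k3^-1 *: 'X^n + k3 *: 'X^(n.+1)
  else k3 *: 'X^n.

Definition t_image (i : 'I_4) : nat -> {poly F} :=
  match val i with
  | 0 => t0_image
  | 1 => t1_image
  | 2 => t2_image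
  | _ => t3_image
  end.

Definition t_scalar (i : 'I_4) : F :=
  match val i with
  | 0 => k0 + k0^-1
  | 1 => k1 + k1^-1
  | 2 => k2 + k2^-1
  | _ => k3 + k3^-1
  end.

Lemma monomial_extD (f : nat -> {poly F}) :
  {morph monomial_ext f : p r / p + r}.
Proof. exact: linearD. Qed.

Lemma monomial_extN (f : nat -> {poly F}) : {morph monomial_ext f : p / - p}.
Proof. exact: linearN. Qed.

Lemma monomial_extZ (f : nat -> {poly F}) a :
  {morph monomial_ext f : p / a *: p}.
Proof. exact: linearZ. Qed.

(** Rewriting with these evaluates a linear extension on any explicit
    combination of monomials. *)
Definition monomial_extE :=
  (monomial_extD, monomial_extN, monomial_extZ, monomial_extXn).

Lemma monomial_ext_quadratic (f : nat -> {poly F}) (a : F) :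
  (forall n, monomial_ext f (f n) = a *: f n - 'X^n) ->
  forall p, monomial_ext f (monomial_ext f p) = a *: monomial_ext f p - p.
Proof.
move=> fE.
apply: (eq_linear_monomial (g := monomial_ext f \o monomial_ext f)
  (h := (a \*: monomial_ext f) \- idfun)) => n /=.
by rewrite !monomial_extXn fE.
Qed.

(** In each degree j, the coefficients of the monomials play the role of
    unknowns, and both sides become rational functions of q ^+ n, the
    parameters and these unknowns. *)
Ltac compare_coefficients n :=
  apply: (iffLR (polyP _ _)) => j; rewrite ?(coefD, coefN, coefZ) ?exprS ?expr0;
  move: (expf_neq0 n hq); set x := q ^+ n => ?; field.

(** The images of 'X^n refer to 'X^(n.-1), which is why 0 is set apart; the
    parity in the two other cases is that of the predecessor.  In the case of
    0 the names n and on are dummies, so that one script runs in all cases. *)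
Ltac parity_cases n :=
  case: n => [|n];
  [pose n := 0%N; have on : odd n = false by []
  |case: (boolP (odd n)) => [on|/negbTE on]].

Lemma t0_quadratic n :
  monomial_ext t0_image (t0_image n) = (k0 + k0^-1) *: t0_image n - 'X^n.
Proof.
parity_cases n; rewrite /t0_image /= ?on /= !monomial_extE /t0_image /= ?on /=;
  by compare_coefficients n; do ?[apply/andP; split].
Qed.

Lemma t1_quadratic n :
  monomial_ext t1_image (t1_image n) = (k1 + k1^-1) *: t1_image n - 'X^n.
Proof.
parity_cases n; rewrite /t1_image /= ?on /= !monomial_extE /t1_image /= ?on /=;
  by compare_coefficients n; do ?[apply/andP; split].
Qed.

Lemma t2_quadratic n :
  monomial_ext t2_image (t2_image n) = (k2 + k2^-1) *: t2_image n - 'X^n.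
Proof.
parity_cases n; rewrite /t2_image /= ?on /= !monomial_extE /t2_image /= ?on /=;
  by compare_coefficients n; do ?[apply/andP; split].
Qed.

Lemma t3_quadratic n :
  monomial_ext t3_image (t3_image n) = (k3 + k3^-1) *: t3_image n - 'X^n.
Proof.
parity_cases n; rewrite /t3_image /= ?on /= !monomial_extE /t3_image /= ?on /=;
  by compare_coefficients n; do ?[apply/andP; split].
Qed.

Local Notation T i := (monomial_ext (t_image i)).

Lemma t_quadratic i n :
  T i (t_image i n) = t_scalar i *: t_image i n - 'X^n.
Proof.
case: i => [[|[|[|[|//]]]] lti]; rewrite /t_image /t_scalar /=.
- exact: t0_quadratic.
- exact: t1_quadratic.
- exact: t2_quadratic.
- exact: t3_quadratic.
Qed.

Lemma t_product_Xn n : T 0 (T 1 (T 2 (T 3 'X^n))) = q^-1 *: 'X^n.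
Proof.
rewrite /t_image /=.
parity_cases n;
  rewrite monomial_extE /t3_image /= ?on /= ?monomial_extE
    /t2_image /= ?on /= ?monomial_extE /t1_image /= ?on /= ?monomial_extE
    /t0_image /= ?on /=;
  by compare_coefficients n; do ?[apply/andP; split].
Qed.

Lemma t_product p : T 0 (T 1 (T 2 (T 3 p))) = q^-1 *: p.
Proof.
move: p; apply: (eq_linear_monomial (g := T 0 \o (T 1 \o (T 2 \o T 3)))
  (h := q^-1 \*: idfun)) => n.
exact: t_product_Xn.
Qed.

End Operators.

(** * The basis and the module *)

(** The monomials are a basis of {poly F}, with \poly_(i < n) a i as the
    combination of coefficients a. *)
Lemma fbasis_of_polynomial_iso (F : fieldType) (q : F) (M : lmodType (udaha q))
    (phi : {additive {poly F} -> M}) :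
  bijective phi -> (forall a p, phi (a *: p) = a *:F phi p) ->
  fbasis (fun n => phi 'X^n).
Proof.
case=> psi phiK psiK phiZ.
have phi_poly n (a : nat -> F) :
    \sum_(i < n) a i *:F phi 'X^i = phi (\poly_(i < n) a i).
  by rewrite poly_def raddf_sum; apply: eq_bigr => i _; rewrite phiZ.
split=> [n a|v]; last first.
  exists (size (psi v)), (fun i => (psi v)`_i).
  by rewrite phi_poly coefK psiK.
rewrite phi_poly -(raddf0 phi) => /(can_inj phiK) a0 i lt_in.
by have := coef_poly n a i; rewrite a0 coef0 lt_in.
Qed.

Theorem proposition3p1 (F : fieldType) (q : F) (hq : q != 0)
    (k0 k1 k2 k3 : F)
    (hk0 : k0 != 0) (hk1 : k1 != 0) (hk2 : k2 != 0) (hk3 : k3 != 0) :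
  exists M : lmodType (udaha q),
    (exists m : nat -> M,
      fbasis m
      /\ ((forall i : nat, (2 <= i)%N -> ~~ odd i ->
             daha_t q 0 *: m i =
               (k0^-1 * q ^- i * (1 - q ^+ i) * (1 - k0 ^+ 2 * q ^+ i))
                 *:F m i.-1
               + (k0 + k0^-1 - k0^-1 * q ^- i) *:F m i)
          /\ (forall i : nat, odd i ->
             daha_t q 0 *: m i = (k0^-1 * q ^- i.+1) *:F (m i - m i.+1))
          /\ daha_t q 0 *: m 0%N = k0 *:F m 0%N)
      /\ ((forall i : nat, (2 <= i)%N -> ~~ odd i ->
             daha_t q 1 *: m i =
               (- k1 * (1 - q ^+ i) * (1 - k0 ^+ 2 * q ^+ i)) *:F m i.-1
               + k1 *:F m i + k1^-1 *:F m i.+1)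
          /\ (forall i : nat, odd i -> daha_t q 1 *: m i = k1^-1 *:F m i)
          /\ daha_t q 1 *: m 0%N = k1 *:F m 0%N + k1^-1 *:F m 1%N)
      /\ ((forall i : nat, ~~ odd i ->
             daha_t q 2 *: m i =
               (k0^-1 * k1^-1 * k3^-1 * q ^- i.+1) *:F (m i - m i.+1))
          /\ (forall i : nat, odd i ->
             daha_t q 2 *: m i =
               ((k0 * k1 * k3 * q ^+ i - k2) * (k0 * k1 * k3 * q ^+ i - k2^-1)
                  / (k0 * k1 * k3 * q ^+ i)) *:F m i.-1
               + (k2 + k2^-1 - k0^-1 * k1^-1 * k3^-1 * q ^- i) *:F m i))
      /\ ((forall i : nat, ~~ odd i -> daha_t q 3 *: m i = k3 *:F m i)
          /\ (forall i : nat, odd i ->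
             daha_t q 3 *: m i =
               (- k3^-1 * (k0 * k1 * k3 * q ^+ i - k2)
                  * (k0 * k1 * k3 * q ^+ i - k2^-1)) *:F m i.-1
               + k3^-1 *:F m i + k3 *:F m i.+1)))
    /\ (forall v : M,
          [/\ daha_c q 0 *: v = (k0 + k0^-1) *:F v,
              daha_c q 1 *: v = (k1 + k1^-1) *:F v,
              daha_c q 2 *: v = (k2 + k2^-1) *:F v
            & daha_c q 3 *: v = (k3 + k3^-1) *:F v]).
Proof.
have [M [phi [phi_bij phiZ phiT cE]]] := udaha_module_of_operators
  (S := fun i => monomial_ext (t_image q k0 k1 k2 k3 i))
  (fun i => monomial_ext_quadratic (t_quadratic hq hk0 hk1 hk2 hk3 i))
  (t_product hq hk0 hk1 hk2 hk3).
have phiX i n : daha_t q i *: phi 'X^n = phi (t_image q k0 k1 k2 k3 i n).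
  by rewrite phiT /= monomial_extXn.
have phiE := (phiZ, raddfD phi, raddfN phi).
exists M; split; last by move=> v; split; rewrite cE.
exists (fun n => phi 'X^n); split; first exact: fbasis_of_polynomial_iso.
split; [split; [|split]|split; [split; [|split]|split; split]].
- by move=> i _ /negbTE on; rewrite phiX /t_image /= /t0_image on !phiE.
- by move=> i on; rewrite phiX /t_image /= /t0_image on !phiE.
- rewrite phiX /t_image /= /t0_image /= !expr0 subrr mulr0 mul0r scale0r add0r.
  by rewrite divr1 addrK phiZ.
- by move=> i _ /negbTE on; rewrite phiX /t_image /= /t1_image on !phiE.
- by move=> i on; rewrite phiX /t_image /= /t1_image on !phiE.
- rewrite phiX /t_image /= /t1_image /= !expr0 subrr mulr0 mul0r scale0r add0r.
  by rewrite !phiE.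
- by move=> i /negbTE on; rewrite phiX /t_image /= /t2_image on !phiE.
- by move=> i on; rewrite phiX /t_image /= /t2_image on !phiE.
- by move=> i /negbTE on; rewrite phiX /t_image /= /t3_image on !phiE.
- by move=> i on; rewrite phiX /t_image /= /t3_image on !phiE.
Qed.
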